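(* Let $a>0$, $b\ge0$, $u_0\in\mathbb{R}$, $c>0$, and let $u$ be a solution on $[0,c]$ of $$\frac{u''}{(1+u'^2)^{3/2}}+\frac1r\,\frac{u'}{\sqrt{1+u'^2}}=ar^2+b,\qquad u(0)=u_0,\quad u'(0)=0.$$ Let $M$ be the axisymmetric surface generated by rotating the graph of $u$ about the $x_3$-axis, and let $A(c)$ be its area. Then, for $r\in(0,c]$, $$\frac1b\Bigl(2-\sqrt{4-b^2r^2}\Bigr)\le u(r)-u_0\le\frac{4-\sqrt{16-r^2(ar^2+2b)^2}}{ar^2+2b},$$ and $$\frac{4\pi}{b^2}\Bigl(2-\sqrt{4-b^2c^2}\Bigr)<A(c)<\frac{8\pi\bigl(4-\sqrt{16-c^2(ac^2+2b)^2}\bigr)}{(ac^2+2b)^2},$$ where the two lower bounds are asserted when $b>0$.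
   Context: A solution $u=u(r)$ is a $C^2$ function on $[0,c]$ satisfying the differential equation for $r\in(0,c]$ together with the initial conditions at $r=0$. The surface $M$ is parametrized by $(r\cos\theta,r\sin\theta,u(r))$, $r\in[0,c]$, $\theta\in\mathbb{R}$; its mean curvature $H$ with respect to the upward normal satisfies $2H=ar^2+b$. Its area is $A(c)=2\pi\int_0^c r\sqrt{1+u'(r)^2}\,dr$. *)

(* Defs.v *)
(* Stdlib real numbers, with Coquelicot's Riemann integral. *)
From Stdlib Require Import Reals.
From Coquelicot Require Import Coquelicot.
Open Scope R_scope.

Definition segment (c : R) : R -> Prop := fun r => 0 <= r <= c.

(* [D_in] and [continue_in] are relative to the segment, hence one-sided at
   its endpoints; no function is constrained outside the segment.  For [0 < c]
   the functions [u'] and [u''] are determined by [u] on the segment. *)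
Record C2_on (c : R) (u u' u'' : R -> R) : Prop := {
  C2_deriv1 : forall r, segment c r -> D_in u u' (segment c) r;
  C2_deriv2 : forall r, segment c r -> D_in u' u'' (segment c) r;
  C2_cont : forall r, segment c r -> continue_in u'' (segment c) r
}.

Record is_solution (a b u0 c : R) (u u' u'' : R -> R) : Prop := {
  sol_C2 : C2_on c u u' u'';
  sol_ode : forall r, 0 < r <= c ->
    u'' r / Rpower (1 + u' r ^ 2) (3 / 2)
    + 1 / r * (u' r / sqrt (1 + u' r ^ 2)) = a * r ^ 2 + b;
  sol_init : u 0 = u0;
  sol_init' : u' 0 = 0
}.

(* Area of the surface (r cos t, r sin t, u r), 0 <= r <= c, in terms of the
   derivative [u'] of the profile [u]. *)
Definition revolution_area (u' : R -> R) (c : R) : R :=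
  2 * PI * RInt (fun r => r * sqrt (1 + u' r ^ 2)) 0 c.

(* Main.v *)
Require Import Defs.
From Stdlib Require Import Reals Lra.
From Coquelicot Require Import Coquelicot.
Open Scope R_scope.

(** Multiplied by [r], the left-hand side of the equation is the derivative of
    [r sin psi], where [psi] is the angle of inclination of the profile, that is
    [sin psi = u' / sqrt (1 + u'^2)].  Integrating from the axis, where
    [r sin psi] vanishes, gives the closed form
      [sin psi = r kappa(r)],  [kappa(r) = (a r^2 + 2 b) / 4]
    ([first_integral]).  Hence [r kappa(r) < 1] on the whole segment, and the
    slope [tan psi] and the area density [r / cos psi] are explicit increasing
    functions of [sin psi].

    On a sphere of curvature [k] through the axis one has [sin psi = k r]
    instead.  Since [b/2 <= kappa(s) <= kappa(r)] for [s <= r], the surface is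
    steeper than the spherical cap of curvature [b/2] and less steep than the
    cap of curvature [kappa(r)].  The lower and upper bounds of the statement
    are the heights and the areas of these two caps: heights are compared by
    monotonicity of the difference of the profiles ([cap_height_le],
    [cap_height_ge]), areas by comparing the densities, strictly away from the
    axis because [a > 0] ([cap_area_lt], [cap_area_gt]). *)

(** * From a segment to the real line *)

(** Composing with the projection onto the segment turns the one-sided
    regularity at the endpoints into two-sided continuity on the line, so that
    the mean value theorem and the continuity calculus for total functions
    apply. *)
Definition clamp (c x : R) : R := Rmax 0 (Rmin x c).

Lemma clamp_in_segment c x : 0 <= c -> segment c (clamp c x).
Proof.
  intros hc; unfold segment, clamp, Rmax, Rmin.
  repeat destruct Rle_dec; lra.
Qed.

Lemma clamp_id c x : segment c x -> clamp c x = x.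
Proof.
  unfold segment, clamp, Rmax, Rmin; intros hx.
  repeat destruct Rle_dec; lra.
Qed.

Lemma clamp_contracts c x y : Rabs (clamp c x - clamp c y) <= Rabs (x - y).
Proof.
  unfold clamp, Rmax, Rmin, Rabs.
  repeat destruct Rle_dec; repeat destruct Rcase_abs; lra.
Qed.

Lemma continuity_clamp (f : R -> R) c x : 0 <= c ->
  (forall r, segment c r -> continue_in f (segment c) r) ->
  continuity_pt (fun t => f (clamp c t)) x.
Proof.
  intros hc hf eps heps.
  destruct (hf (clamp c x) (clamp_in_segment c x hc) eps heps)
    as [alp [halp H]].
  exists alp; split; [exact halp|].
  simpl; unfold Rdist in *; intros t [_ ht].
  destruct (Req_dec (clamp c t) (clamp c x)) as [e | ne].
  - rewrite e, Rminus_diag, Rabs_R0; exact heps.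
  - apply (H (clamp c t)); split.
    + split; [apply clamp_in_segment; exact hc | intros e; apply ne; auto].
    + apply Rle_lt_trans with (2 := ht); apply clamp_contracts.
Qed.

Lemma is_derive_clamp (f f' : R -> R) c x : 0 < x < c ->
  D_in f f' (segment c) x ->
  is_derive (fun t => f (clamp c t)) x (f' x).
Proof.
  intros hx hf; apply is_derive_Reals, derivable_pt_lim_D_in.
  intros eps heps.
  destruct (hf eps heps) as [alp [halp H]].
  exists (Rmin alp (Rmin x (c - x))); split.
  { repeat apply Rmin_glb_lt; lra. }
  simpl; unfold Rdist in *; intros t [[_ ne] ht].
  assert (h1 := Rmin_l alp (Rmin x (c - x))).
  assert (h2 := Rmin_r alp (Rmin x (c - x))).
  assert (h3 := Rmin_l x (c - x)).
  assert (h4 := Rmin_r x (c - x)).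
  assert (st : segment c t).
  { apply Rabs_def2 in ht; unfold segment; lra. }
  rewrite !clamp_id by (auto; unfold segment; lra).
  apply (H t); split; [split; auto | simpl; unfold Rdist; lra].
Qed.

Lemma nondecreasing_of_deriv (f df : R -> R) x y : x <= y ->
  (forall t, x <= t <= y -> continuity_pt f t) ->
  (forall t, x < t < y -> is_derive f t (df t)) ->
  (forall t, x <= t <= y -> 0 <= df t) ->
  f x <= f y.
Proof.
  intros hxy hc hd hp.
  destruct (MVT_gen f x y df) as [z [hz E]];
    rewrite ?Rmin_left, ?Rmax_right in * by exact hxy; auto.
  assert (0 <= df z * (y - x)) by (apply Rmult_le_pos; [auto | lra]).
  lra.
Qed.

Lemma continuity_pt_of_ex_derive (f : R -> R) x :
  ex_derive f x -> continuity_pt f x.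
Proof.
  intros hf; apply continuity_pt_filterlim.
  exact (ex_derive_continuous (V := R_NormedModule) f x hf).
Qed.

Lemma continuity_sqrt_1_sqr (v : R -> R) x : continuity_pt v x ->
  continuity_pt (fun t => sqrt (1 + v t ^ 2)) x.
Proof.
  intros hv; change (continuity_pt (comp (fun y => sqrt (1 + y ^ 2)) v) x).
  apply continuity_pt_comp; [exact hv |].
  apply continuity_pt_of_ex_derive.
  assert (H := pow2_ge_0 (v x)); auto_derive; simpl in H; lra.
Qed.

(** * Slope as a function of the sine of the inclination *)

Definition tan_of_sin (x : R) : R := x / sqrt (1 - x ^ 2).

Lemma sqr_lt_1 x : 0 <= x < 1 -> x ^ 2 < 1.
Proof. intros h; nra. Qed.

Lemma tan_of_sin_le x y : 0 <= x -> x <= y -> y < 1 ->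
  tan_of_sin x <= tan_of_sin y.
Proof.
  intros hx hxy hy; unfold tan_of_sin.
  assert (x ^ 2 <= y ^ 2) by (apply pow_incr; lra).
  assert (y ^ 2 < 1) by (apply sqr_lt_1; lra).
  apply Rmult_le_compat; [lra | | exact hxy | ].
  - apply Rlt_le, Rinv_0_lt_compat, sqrt_lt_R0; lra.
  - apply Rinv_le_contravar; [apply sqrt_lt_R0; lra | apply sqrt_le_1_alt; lra].
Qed.

Lemma sec_of_sin_lt x y : 0 <= x -> x < y -> y < 1 ->
  / sqrt (1 - x ^ 2) < / sqrt (1 - y ^ 2).
Proof.
  intros hx hxy hy.
  assert (y ^ 2 < 1) by (apply sqr_lt_1; lra).
  assert (x ^ 2 < y ^ 2) by nra.
  apply Rinv_lt_contravar.
  - apply Rmult_lt_0_compat; apply sqrt_lt_R0; lra.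
  - apply sqrt_lt_1_alt; lra.
Qed.

Lemma sqrt_1_tan_of_sin x : x ^ 2 < 1 ->
  sqrt (1 + tan_of_sin x ^ 2) = / sqrt (1 - x ^ 2).
Proof.
  intros h; unfold tan_of_sin.
  assert (hs : 0 < sqrt (1 - x ^ 2)) by (apply sqrt_lt_R0; lra).
  assert (hq : sqrt (1 - x ^ 2) ^ 2 = 1 - x ^ 2) by (apply pow2_sqrt; lra).
  rewrite <- sqrt_inv; f_equal.
  unfold Rdiv; rewrite Rpow_mult_distr, pow_inv, hq; field; lra.
Qed.

Lemma sin_of_tan_sqr v : 1 - (v / sqrt (1 + v ^ 2)) ^ 2 = / (1 + v ^ 2).
Proof.
  assert (0 <= v ^ 2) by apply pow2_ge_0.
  unfold Rdiv; rewrite Rpow_mult_distr, pow_inv, pow2_sqrt by lra; field; lra.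
Qed.

Lemma tan_of_sin_of_tan v : tan_of_sin (v / sqrt (1 + v ^ 2)) = v.
Proof.
  unfold tan_of_sin; rewrite sin_of_tan_sqr, sqrt_inv.
  assert (0 <= v ^ 2) by apply pow2_ge_0.
  assert (0 < sqrt (1 + v ^ 2)) by (apply sqrt_lt_R0; lra).
  field; lra.
Qed.

(** * Spherical caps *)

(** The height, at distance [r] from the axis, of the lower cap of the sphere
    of radius [1 / k], measured from its lowest point. *)
Definition cap_height (k r : R) : R := (1 - sqrt (1 - (k * r) ^ 2)) / k.

Lemma cap_height_0 k : cap_height k 0 = 0.
Proof.
  unfold cap_height, Rdiv.
  replace (1 - (k * 0) ^ 2) with 1 by ring; rewrite sqrt_1; ring.
Qed.

Lemma is_derive_cap_height k r : 0 < k -> (k * r) ^ 2 < 1 ->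
  is_derive (cap_height k) r (tan_of_sin (k * r)).
Proof.
  intros hk h; unfold cap_height, tan_of_sin.
  assert (0 < sqrt (1 - (k * r) ^ 2)) by (apply sqrt_lt_R0; lra).
  auto_derive.
  - lra.
  - replace (1 + - (k * r * (k * r * 1))) with (1 - (k * r) ^ 2) by ring.
    field; lra.
Qed.

Lemma continuous_cap_density k x : (k * x) ^ 2 < 1 ->
  continuous (fun r => r * / sqrt (1 - (k * r) ^ 2)) x.
Proof.
  intros hlt; apply (ex_derive_continuous (V := R_NormedModule)).
  assert (0 < sqrt (1 - (k * x) ^ 2)) by (apply sqrt_lt_R0; lra).
  auto_derive.
  replace (1 + - (k * x * (k * x * 1))) with (1 - (k * x) ^ 2) by ring.
  split; lra.
Qed.

(** Archimedes: up to the factor [2 PI] this is the area of the cap, the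
    product of the radius [1 / k] and the height. *)
Lemma is_RInt_cap k c : 0 < k -> 0 <= c -> k * c < 1 ->
  is_RInt (fun r => r * / sqrt (1 - (k * r) ^ 2)) 0 c (cap_height k c / k).
Proof.
  intros hk hc hkc.
  assert (hlt : forall x, Rmin 0 c <= x <= Rmax 0 c -> (k * x) ^ 2 < 1).
  { intros x; rewrite Rmin_left, Rmax_right by exact hc; intros hx.
    apply sqr_lt_1; nra. }
  replace (cap_height k c / k)
    with (minus (/ k * cap_height k c) (/ k * cap_height k 0)).
  2: { rewrite cap_height_0; unfold minus, plus, opp; simpl; field; lra. }
  apply (is_RInt_derive (fun x => / k * cap_height k x)).
  - intros x hx; specialize (hlt x hx).
    replace (x * / sqrt (1 - (k * x) ^ 2)) with (/ k * tan_of_sin (k * x)).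
    2: { unfold tan_of_sin; field; split; [| lra].
         apply Rgt_not_eq, sqrt_lt_R0; lra. }
    apply is_derive_scal, is_derive_cap_height; auto.
  - intros x hx; apply continuous_cap_density, hlt, hx.
Qed.

(** * Comparison of a profile with a cap *)

(** Here [sigma s] is the sine of the inclination of the profile at distance
    [s] from the axis, to be compared with [k * s] on the cap. *)
Section Comparison.

Variables (sigma : R -> R) (k r : R).
Hypothesis hk : 0 < k.

Section Height.

Variable U : R -> R.
Hypotheses (hr : 0 <= r)
  (U_cont : forall s, 0 <= s <= r -> continuity_pt U s)
  (U_deriv : forall s, 0 < s < r -> is_derive U s (tan_of_sin (sigma s))).

Lemma cap_height_le :
  (forall s, 0 <= s <= r -> k * s <= sigma s < 1) ->
  cap_height k r <= U r - U 0.
Proof.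
  intros hs.
  assert (hlt : forall s, 0 <= s <= r -> (k * s) ^ 2 < 1).
  { intros s h; specialize (hs s h); apply sqr_lt_1; nra. }
  assert (H : U 0 - cap_height k 0 <= U r - cap_height k r).
  { apply (nondecreasing_of_deriv (fun s => U s - cap_height k s)
      (fun s => tan_of_sin (sigma s) - tan_of_sin (k * s))); [exact hr | | |].
    - intros s h; apply continuity_pt_minus; [auto |].
      apply continuity_pt_of_ex_derive.
      eexists; apply is_derive_cap_height; auto.
    - intros s h; apply (is_derive_minus (V := R_NormedModule)); [auto |].
      apply is_derive_cap_height; [exact hk | apply hlt; lra].
    - intros s h; specialize (hs s h).
      enough (tan_of_sin (k * s) <= tan_of_sin (sigma s)) by lra.
      apply tan_of_sin_le; nra. }
  rewrite cap_height_0 in H; lra.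
Qed.

Lemma cap_height_ge :
  (forall s, 0 <= s <= r -> 0 <= sigma s <= k * s) -> k * r < 1 ->
  U r - U 0 <= cap_height k r.
Proof.
  intros hs hkr.
  assert (hlt : forall s, 0 <= s <= r -> (k * s) ^ 2 < 1).
  { intros s h; apply sqr_lt_1; nra. }
  assert (H : cap_height k 0 - U 0 <= cap_height k r - U r).
  { apply (nondecreasing_of_deriv (fun s => cap_height k s - U s)
      (fun s => tan_of_sin (k * s) - tan_of_sin (sigma s))); [exact hr | | |].
    - intros s h; apply continuity_pt_minus; [| auto].
      apply continuity_pt_of_ex_derive.
      eexists; apply is_derive_cap_height; auto.
    - intros s h; apply (is_derive_minus (V := R_NormedModule)); [| auto].
      apply is_derive_cap_height; [exact hk | apply hlt; lra].
    - intros s h; specialize (hs s h).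
      enough (tan_of_sin (sigma s) <= tan_of_sin (k * s)) by lra.
      apply tan_of_sin_le; nra. }
  rewrite cap_height_0 in H; lra.
Qed.

End Height.

Section Area.

Variable v : R -> R.
Hypotheses (hr : 0 < r)
  (v_cont : forall s, 0 <= s <= r -> continuity_pt v s)
  (v_eq : forall s, 0 <= s <= r -> v s = tan_of_sin (sigma s)).

Lemma continuous_area_density s : 0 <= s <= r ->
  continuous (fun t => t * sqrt (1 + v t ^ 2)) s.
Proof.
  intros h; apply continuity_pt_filterlim.
  apply continuity_pt_mult; [apply continuity_pt_id |].
  apply continuity_sqrt_1_sqr; auto.
Qed.

Lemma cap_area_lt :
  (forall s, 0 < s <= r -> k * s < sigma s < 1) ->
  cap_height k r / k < RInt (fun s => s * sqrt (1 + v s ^ 2)) 0 r.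
Proof.
  intros hs.
  assert (hkr : k * r < 1) by (specialize (hs r); lra).
  rewrite <- (is_RInt_unique _ _ _ _ (is_RInt_cap k r hk (Rlt_le _ _ hr) hkr)).
  apply RInt_lt; [exact hr | exact continuous_area_density | |].
  - intros s h; apply continuous_cap_density, sqr_lt_1; nra.
  - intros s h; rewrite v_eq by lra.
    assert (hs1 : k * s < sigma s < 1) by (apply hs; lra).
    assert (0 < k * s) by (apply Rmult_lt_0_compat; lra).
    rewrite sqrt_1_tan_of_sin by (apply sqr_lt_1; lra).
    apply Rmult_lt_compat_l; [lra | apply sec_of_sin_lt; lra].
Qed.

Lemma cap_area_gt :
  (forall s, 0 < s < r -> 0 <= sigma s < k * s) -> k * r < 1 ->
  RInt (fun s => s * sqrt (1 + v s ^ 2)) 0 r < cap_height k r / k.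
Proof.
  intros hs hkr.
  rewrite <- (is_RInt_unique _ _ _ _ (is_RInt_cap k r hk (Rlt_le _ _ hr) hkr)).
  apply RInt_lt; [exact hr | | exact continuous_area_density |].
  - intros s h; apply continuous_cap_density, sqr_lt_1; nra.
  - intros s h; rewrite v_eq by lra; specialize (hs s h).
    assert (k * s < 1) by nra.
    rewrite sqrt_1_tan_of_sin by (apply sqr_lt_1; lra).
    apply Rmult_lt_compat_l; [lra | apply sec_of_sin_lt; lra].
Qed.

End Area.

End Comparison.

(** * The first integral of the equation *)

(** On the surface generated by a solution this is [sin psi / r], the principal
    curvature in the direction of rotation. *)
Definition kappa (a b r : R) : R := (a * r ^ 2 + 2 * b) / 4.

Lemma Rpower_3_2 x : 0 < x -> Rpower x (3 / 2) = x * sqrt x.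
Proof.
  intros hx; replace (3 / 2) with (1 + / 2) by field.
  rewrite Rpower_plus, Rpower_1, Rpower_sqrt; auto.
Qed.

Section Solution.

Variables (a b u0 c : R) (u u' u'' : R -> R).
Hypotheses (hc : 0 < c) (hu : is_solution a b u0 c u u' u'').

Lemma profile_continuity x : continuity_pt (fun t => u (clamp c t)) x.
Proof.
  apply continuity_clamp; [lra |]; intros r hr.
  exact (cont_deriv _ _ _ _ (C2_deriv1 _ _ _ _ (sol_C2 _ _ _ _ _ _ _ hu) r hr)).
Qed.

Lemma slope_continuity x : continuity_pt (fun t => u' (clamp c t)) x.
Proof.
  apply continuity_clamp; [lra |]; intros r hr.
  exact (cont_deriv _ _ _ _ (C2_deriv2 _ _ _ _ (sol_C2 _ _ _ _ _ _ _ hu) r hr)).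
Qed.

Lemma profile_derive x : 0 < x < c ->
  is_derive (fun t => u (clamp c t)) x (u' x).
Proof.
  intros hx; apply is_derive_clamp; [exact hx |].
  apply (C2_deriv1 _ _ _ _ (sol_C2 _ _ _ _ _ _ _ hu)); unfold segment; lra.
Qed.

Lemma slope_derive x : 0 < x < c ->
  is_derive (fun t => u' (clamp c t)) x (u'' x).
Proof.
  intros hx; apply is_derive_clamp; [exact hx |].
  apply (C2_deriv2 _ _ _ _ (sol_C2 _ _ _ _ _ _ _ hu)); unfold segment; lra.
Qed.

(** The equation says that [r sin psi - r^2 kappa(r)] has derivative zero
    inside the segment; it vanishes on the axis. *)
Lemma first_integral r : 0 < r <= c ->
  u' r / sqrt (1 + u' r ^ 2) = kappa a b r * r.
Proof.
  intros hr.
  set (V := fun t => u' (clamp c t)).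
  assert (hpos : forall y, 0 < 1 + y ^ 2).
  { intros y; assert (H := pow2_ge_0 y); lra. }
  assert (hsq : forall y, 0 < sqrt (1 + y ^ 2)).
  { intros y; apply sqrt_lt_R0, hpos. }
  set (G := fun t => t * (V t / sqrt (1 + V t ^ 2)) - kappa a b t * t ^ 2).
  (* The zero function is used as derivative also at the endpoints, where [G]
     need not be differentiable, so the position of [z] does not matter. *)
  destruct (MVT_gen G 0 r (fun _ => 0)) as [z [_ E]].
  - rewrite Rmin_left, Rmax_right by lra; intros x hx.
    assert (dV : is_derive V x (u'' x)) by (apply slope_derive; lra).
    assert (Vx : V x = u' x) by (unfold V; rewrite clamp_id; unfold segment; lra).
    assert (ode := sol_ode _ _ _ _ _ _ _ hu x ltac:(lra)).
    rewrite Rpower_3_2 in ode by apply hpos.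
    unfold G, kappa; auto_derive.
    + assert (H := hpos (V x)); assert (H' := hsq (V x)).
      simpl in H, H'; repeat split; try lra; eexists; exact dV.
    + replace (Derive (fun x0 => V x0) x) with (u'' x)
        by (symmetry; apply is_derive_unique; exact dV).
      rewrite Vx; replace (u' x * (u' x * 1)) with (u' x ^ 2) by ring.
      assert (hS := hsq (u' x)).
      assert (hq : sqrt (1 + u' x ^ 2) ^ 2 = 1 + u' x ^ 2)
        by (apply pow2_sqrt, Rlt_le, hpos).
      set (S := sqrt (1 + u' x ^ 2)) in *.
      rewrite <- hq in ode.
      assert (hv : u' x ^ 2 = S ^ 2 - 1) by lra.
      assert (ode' : u'' x / S ^ 3 + u' x / S / x = a * x ^ 2 + b).
      { rewrite <- ode; field; lra. }
      transitivity (x * (u'' x / S ^ 3 + u' x / S / x - (a * x ^ 2 + b))).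
      2: { rewrite ode'; ring. }
      transitivity (u' x / S + x * (u'' x * (S ^ 2 - u' x ^ 2)) / S ^ 3
                    - x * (a * x ^ 2 + b)).
      * field; lra.
      * rewrite hv; field; lra.
  - intros x _; unfold G.
    assert (cV : continuity_pt V x) by apply slope_continuity.
    apply continuity_pt_minus.
    + apply continuity_pt_mult; [apply continuity_pt_id |].
      apply continuity_pt_div; [exact cV | | apply Rgt_not_eq, hsq].
      apply continuity_sqrt_1_sqr; exact cV.
    + apply continuity_pt_of_ex_derive.
      unfold kappa; auto_derive; exact I.
  - assert (Vr : V r = u' r) by (unfold V; rewrite clamp_id; unfold segment; lra).
    unfold G in E; rewrite Vr in E.
    apply Rmult_eq_reg_l with r; [| lra].
    transitivity (kappa a b r * r ^ 2); [| ring].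
    transitivity (kappa a b r * r ^ 2 + 0 * (r - 0)); [| ring].
    rewrite <- E; ring.
Qed.

Lemma slope_eq r : 0 <= r <= c -> u' r = tan_of_sin (kappa a b r * r).
Proof.
  intros [[hr | <-] hrc].
  - rewrite <- first_integral by lra; symmetry; apply tan_of_sin_of_tan.
  - rewrite (sol_init' _ _ _ _ _ _ _ hu); unfold tan_of_sin, Rdiv.
    rewrite Rmult_0_r; ring.
Qed.

Lemma kappa_lt_1 r : 0 <= r <= c -> kappa a b r * r < 1.
Proof.
  intros [[hr | <-] hrc]; [| rewrite Rmult_0_r; lra].
  rewrite <- first_integral by lra.
  assert (H := sin_of_tan_sqr (u' r)).
  assert (H' := pow2_ge_0 (u' r)).
  assert (0 < / (1 + u' r ^ 2)) by (apply Rinv_0_lt_compat; lra).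
  nra.
Qed.

End Solution.

(** * The estimates *)

Lemma sqrt_scale m x : 0 <= m -> sqrt (m ^ 2 * x) = m * sqrt x.
Proof.
  intros hm; rewrite sqrt_mult_alt by apply pow2_ge_0.
  rewrite sqrt_pow2; auto.
Qed.

Lemma cap_height_half b r : 0 < b ->
  cap_height (b / 2) r = 1 / b * (2 - sqrt (4 - b ^ 2 * r ^ 2)).
Proof.
  intros hb; unfold cap_height.
  replace (4 - b ^ 2 * r ^ 2) with (2 ^ 2 * (1 - (b / 2 * r) ^ 2)) by field.
  rewrite sqrt_scale by lra; field; lra.
Qed.

Lemma cap_height_kappa a b r : 0 < kappa a b r ->
  cap_height (kappa a b r) r =
    (4 - sqrt (16 - r ^ 2 * (a * r ^ 2 + 2 * b) ^ 2)) / (a * r ^ 2 + 2 * b).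
Proof.
  intros hk; unfold cap_height.
  replace (16 - r ^ 2 * (a * r ^ 2 + 2 * b) ^ 2)
    with (4 ^ 2 * (1 - (kappa a b r * r) ^ 2)) by (unfold kappa; field).
  rewrite sqrt_scale by lra; revert hk; unfold kappa; intros hk.
  field; lra.
Qed.

Lemma kappa_increasing a b s r : 0 < a -> 0 <= s < r -> kappa a b s < kappa a b r.
Proof.
  intros ha h; unfold kappa.
  assert (s ^ 2 < r ^ 2) by nra.
  nra.
Qed.

Lemma kappa_0 a b : kappa a b 0 = b / 2.
Proof. unfold kappa; field. Qed.

Theorem theorem7 (a b u0 c : R) (u u' u'' : R -> R)
  (ha : 0 < a) (hb : 0 <= b) (hc : 0 < c)
  (hu : is_solution a b u0 c u u' u'') :
  (forall r : R, 0 < r <= c ->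
     (0 < b -> 1 / b * (2 - sqrt (4 - b ^ 2 * r ^ 2)) <= u r - u0) /\
     u r - u0 <=
       (4 - sqrt (16 - r ^ 2 * (a * r ^ 2 + 2 * b) ^ 2)) / (a * r ^ 2 + 2 * b)) /\
  (0 < b ->
     4 * PI / b ^ 2 * (2 - sqrt (4 - b ^ 2 * c ^ 2)) < revolution_area u' c) /\
  revolution_area u' c <
    8 * PI * (4 - sqrt (16 - c ^ 2 * (a * c ^ 2 + 2 * b) ^ 2))
      / (a * c ^ 2 + 2 * b) ^ 2.
Proof.
  assert (hPI := PI_RGT_0).
  assert (hk : forall s r, 0 <= s < r -> kappa a b s < kappa a b r).
  { intros s r; apply kappa_increasing; exact ha. }
  assert (hk0 : forall r, 0 < r -> b / 2 < kappa a b r).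
  { intros r hr; rewrite <- (kappa_0 a); apply hk; lra. }
  assert (hk1 : forall s, 0 <= s <= c -> kappa a b s * s < 1).
  { intros s; exact (kappa_lt_1 _ _ _ _ _ _ _ hc hu s). }
  assert (sin_ge : forall s, 0 < s -> b / 2 * s < kappa a b s * s).
  { intros s hs; apply Rmult_lt_compat_r; auto. }
  assert (sin_le : forall s r, 0 < s < r -> kappa a b s * s < kappa a b r * s).
  { intros s r hs; apply Rmult_lt_compat_r; [| apply hk]; lra. }
  split; [| split].
  - intros r hr.
    set (U := fun t => u (clamp c t)).
    assert (hkr := hk0 r (proj1 hr)).
    assert (Ur : u r - u0 = U r - U 0).
    { unfold U; rewrite !clamp_id by (unfold segment; lra).
      rewrite (sol_init _ _ _ _ _ _ _ hu); reflexivity. }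
    assert (U_deriv : forall s, 0 < s < r ->
              is_derive U s (tan_of_sin (kappa a b s * s))).
    { intros s hs; rewrite <- (slope_eq _ _ _ _ _ _ _ hc hu) by lra.
      apply (profile_derive _ _ _ _ _ _ _ hu); lra. }
    assert (U_cont : forall s, 0 <= s <= r -> continuity_pt U s).
    { intros s _; apply (profile_continuity _ _ _ _ _ _ _ hc hu). }
    rewrite Ur; split.
    + intros hb'; rewrite <- cap_height_half by exact hb'.
      apply (cap_height_le (fun s => kappa a b s * s)); auto; try lra.
      intros s hs; split; [| apply hk1; lra].
      destruct (proj1 hs) as [hs0 | <-]; [apply Rlt_le; auto | lra].
    + rewrite <- cap_height_kappa by lra.
      apply (cap_height_ge (fun s => kappa a b s * s)); auto; try lra.
      * intros s [hs0 hsr]; split.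
        -- destruct hs0 as [hs0 | <-]; [| lra].
           specialize (sin_ge s hs0).
           assert (0 <= b / 2 * s) by (apply Rmult_le_pos; lra); lra.
        -- destruct hs0 as [hs0 | <-]; [| lra].
           destruct hsr as [hsr | ->]; [apply Rlt_le; auto | lra].
      * apply hk1; lra.
  - intros hb'; unfold revolution_area.
    set (v := fun t => u' (clamp c t)).
    rewrite (RInt_ext _ (fun r => r * sqrt (1 + v r ^ 2))).
    2: { intros x; rewrite Rmin_left, Rmax_right by lra; intros hx.
         unfold v; rewrite clamp_id; [reflexivity | unfold segment; lra]. }
    replace (4 * PI / b ^ 2 * (2 - sqrt (4 - b ^ 2 * c ^ 2)))
      with (2 * PI * (cap_height (b / 2) c / (b / 2))).
    2: { rewrite cap_height_half by exact hb'; field; lra. }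
    apply Rmult_lt_compat_l; [lra |].
    apply (cap_area_lt (fun s => kappa a b s * s)); try lra.
    + intros s _; apply (slope_continuity _ _ _ _ _ _ _ hc hu).
    + intros s hs; unfold v; rewrite clamp_id by exact hs.
      apply (slope_eq _ _ _ _ _ _ _ hc hu s hs).
    + intros s hs; split; [apply sin_ge | apply hk1]; lra.
  - unfold revolution_area.
    set (v := fun t => u' (clamp c t)).
    assert (hkc := hk0 c hc).
    rewrite (RInt_ext _ (fun r => r * sqrt (1 + v r ^ 2))).
    2: { intros x; rewrite Rmin_left, Rmax_right by lra; intros hx.
         unfold v; rewrite clamp_id; [reflexivity | unfold segment; lra]. }
    replace (8 * PI * (4 - sqrt (16 - c ^ 2 * (a * c ^ 2 + 2 * b) ^ 2))
               / (a * c ^ 2 + 2 * b) ^ 2)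
      with (2 * PI * (cap_height (kappa a b c) c / kappa a b c)).
    2: { rewrite cap_height_kappa by lra.
         revert hkc; unfold kappa; intros hkc; field; lra. }
    apply Rmult_lt_compat_l; [lra |].
    apply (cap_area_gt (fun s => kappa a b s * s)); try lra.
    + intros s _; apply (slope_continuity _ _ _ _ _ _ _ hc hu).
    + intros s hs; unfold v; rewrite clamp_id by exact hs.
      apply (slope_eq _ _ _ _ _ _ _ hc hu s hs).
    + intros s hs; split; [| auto].
      specialize (sin_ge s (proj1 hs)).
      assert (0 <= b / 2 * s) by (apply Rmult_le_pos; lra); lra.
    + apply hk1; lra.
Qed.
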